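(* Let $K\in\mathbb{R}^{N\times N}$, $N=n^2$, let $1\le k<N$, let $K_{\mathrm{TSVD}}=U_k\Sigma_kV_k^T$ be the true truncated SVD operator of $K$, and let $\widehat K_{\mathrm{TSVD}}=\widehat U_k\widehat\Sigma_k\widehat V_k^T$ be its approximation constructed from the Kronecker sum decomposition of $K$ as described in the context, where $\sigma_k>0$ and $\widehat\sigma_k>0$. Define $\varphi=(1+\sqrt5)/2$. Then $$\frac{\left\|K_{\mathrm{TSVD}}^\dagger-\widehat K_{\mathrm{TSVD}}^\dagger\right\|}{\left\|K_{\mathrm{TSVD}}^\dagger\right\|}\le\frac{\varphi}{\widehat\sigma_k}\left(\sigma_1\|V_k^T\widehat V_0\|+\|\widehat W_{21}\|\right).$$
   Context: All norms are spectral (2-)norms. $^\dagger$ is the Moore–Penrose pseudoinverse. $\otimes$ is the Kronecker product, $(A\otimes B)=[a_{ij}B]$ in block form. True SVD: $K=U\Sigma V^T$ with $U,V$ orthogonal and $\Sigma=\mathrm{diag}(\sigma_1,\dots,\sigma_N)$, $\sigma_1\ge\cdots\ge\sigma_N\ge0$. $U_k,V_k$ are the first $k$ columns of $U,V$; $U_0,V_0$ are the remaining $N-k$ columns; $\Sigma_k=\mathrm{diag}(\sigma_1,\dots,\sigma_k)$. Thus $K_{\mathrm{TSVD}}^\dagger=V_k\Sigma_k^{-1}U_k^T$. Kronecker sum decomposition: $K=\sum_{i=1}^R A_i\otimes B_i$ with $A_i,B_i\in\mathbb{R}^{n\times n}$, where $R$ is the Kronecker rank of $K$ (the least number of terms for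 which such an exact decomposition exists). It is obtained as follows. Let $\widetilde K$ be the $n^2\times n^2$ rearrangement of $K$, the linear rearrangement of entries such that $\widetilde K=\mathrm{vec}(A)\mathrm{vec}(B)^T$ whenever $K=A\otimes B$ with $A,B\in\mathbb{R}^{n\times n}$ ($\mathrm{vec}$ stacks columns). If $\widetilde K=\sum_{i=1}^R s_i u_iv_i^T$ is an SVD with $s_1\ge\dots\ge s_R>0$, then $\mathrm{vec}(A_i)=\sqrt{s_i}\,u_i$ and $\mathrm{vec}(B_i)=\sqrt{s_i}\,v_i$. Construction of the approximation: Let $A_1=U_A\Sigma_AV_A^T$ and $B_1=U_B\Sigma_BV_B^T$ be SVDs. Put $U_1=U_A\otimes U_B$, $\Sigma_1=\Sigma_A\otimes\Sigma_B$, $V_1=V_A\otimes V_B$, and $W=U_1^T\left(\sum_{i=2}^R A_i\otimes B_i\right)V_1$, so that $K=U_1(\Sigma_1+W)V_1^T$. Let $P$ be a permutation matrix such that the diagonal of $P^T\Sigma_1P=\mathrm{diag}(\sigma_{1,1},\dots,\sigma_{1,N})$ is in descending order. Put $\Sigma_{1,k}=\mathrm{diag}(\sigma_{1,1},\dots,\sigma_{1,k})$ and $\widehat\Sigma_0=\mathrm{diag}(\sigma_{1,k+1},\dots,\sigma_{1,N})$, and partition conformally $$P^TWP=\begin{bmatrix}W_{11}&W_{12}\\ W_{21}&W_{22}\end{bmatrix},\qquad W_{11}\in\mathbb{R}^{k\times k}.$$ Let $\Sigma_{1,k}+W_{11}=\widehat U_t\widehat\Sigma_t\widehat V_t^T$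 be an SVD of this $k\times k$ matrix, with $\widehat\Sigma_k:=\widehat\Sigma_t=\mathrm{diag}(\widehat\sigma_1,\dots,\widehat\sigma_k)$, $\widehat\sigma_1\ge\dots\ge\widehat\sigma_k\ge0$ (the approximate singular values). Define $\widehat W_{12}=\widehat U_t^TW_{12}$, $\widehat W_{21}=W_{21}\widehat V_t$, $$\widehat U=U_1P\begin{bmatrix}\widehat U_t&0\\0&I\end{bmatrix},\qquad \widehat V=V_1P\begin{bmatrix}\widehat V_t&0\\0&I\end{bmatrix},$$ so that $$K=\widehat U\left(\begin{bmatrix}\widehat\Sigma_k&0\\0&\widehat\Sigma_0\end{bmatrix}+\begin{bmatrix}0&\widehat W_{12}\\ \widehat W_{21}&W_{22}\end{bmatrix}\right)\widehat V^T.$$ $\widehat U_k,\widehat V_k$ are the first $k$ columns of $\widehat U,\widehat V$, and $\widehat U_0,\widehat V_0$ the remaining $N-k$ columns. *)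

(* Defs.v *)
From mathcomp Require Import all_boot all_order all_algebra.
From mathcomp Require Import boolp classical_sets reals.
From mathcomp Require Import mxtens.

Set Implicit Arguments.
Unset Strict Implicit.
Unset Printing Implicit Defensive.

Import Order.TTheory GRing.Theory Num.Theory.

Local Open Scope ring_scope.

(* mxtens_index (i, j) has value i * n + j, so A *t B is the block matrix
   [a_ij B] *)
Notation "A *t B" := (tensmx A B)
  (at level 40, left associativity, format "A  *t  B") : ring_scope.

Section Norms.
Variable R : realType.

(* The norm `|x| of MathComp-Analysis on matrices is the max norm. *)
Definition norm2 n (x : 'cV[R]_n) : R := Num.sqrt (\sum_(i < n) x i 0 ^+ 2).

Definition spnorm m n (A : 'M[R]_(m, n)) : R :=
  sup [set norm2 (A *m x) | x in [set x : 'cV[R]_n | norm2 x <= 1]]%classic.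

Definition golden : R := (1 + Num.sqrt 5) / 2.

End Norms.

Section PseudoInverse.
Variable R : realType.

Definition is_pinv m n (A : 'M[R]_(m, n)) (X : 'M[R]_(n, m)) : Prop :=
  [/\ A *m X *m A = A, X *m A *m X = X,
      (A *m X)^T = A *m X & (X *m A)^T = X *m A].

Definition pinv m n (A : 'M[R]_(m, n)) : 'M[R]_(n, m) :=
  xget 0 [set X | is_pinv A X]%classic.

Lemma is_pinv_uniq m n (A : 'M[R]_(m, n)) X Y :
  is_pinv A X -> is_pinv A Y -> X = Y.
Proof.
move=> [a1 a2 a3 a4] [b1 b2 b3 b4].
have AXY : A *m X = A *m Y.
  rewrite -a3 -{1}b1 -mulmxA trmx_mul a3 b3 mulmxA.
  by rewrite a1.
have XYA : X *m A = Y *m A.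
  rewrite -a4 -{1}b1 !mulmxA -(mulmxA _ Y A) trmx_mul a4 b4.
  by rewrite -mulmxA (mulmxA A X A) a1.
by rewrite -a2 XYA -mulmxA AXY mulmxA b2.
Qed.

Lemma gram_unit m n (F : 'M[R]_(m, n)) : row_free F -> F *m F^T \in unitmx.
Proof.
move=> freeF; rewrite -row_free_unit -kermx_eq0; apply/rowV0P => x.
move=> /sub_kermxP; rewrite mulmxA => xFF0.
have xF0 : x *m F = 0.
  have : (x *m F) *m (x *m F)^T = 0 by rewrite trmx_mul mulmxA xFF0 mul0mx.
  move=> /matrixP /(_ 0 0); rewrite !mxE => /eqP.
  rewrite psumr_eq0 => [/allP s0 | j _]; last by rewrite !mxE -expr2 sqr_ge0.
  apply/rowP => j; have := s0 j (mem_index_enum j).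
  by rewrite !mxE -expr2 sqrf_eq0 => /eqP.
by apply: (row_free_inj freeF); rewrite xF0 mul0mx.
Qed.

Lemma is_pinv_exists m n (A : 'M[R]_(m, n)) : exists X, is_pinv A X.
Proof.
have [r [C [F [AE uC uF]]]] : exists r (C : 'M[R]_(m, r)) (F : 'M[R]_(r, n)),
    [/\ A = C *m F, C^T *m C \in unitmx & F *m F^T \in unitmx].
  exists (\rank A), (col_base A), (row_base A); split.
  - by rewrite mulmx_base.
  - rewrite -[X in _ *m X]trmxK; apply: gram_unit.
    by rewrite /row_free mxrank_tr; exact: col_base_full.
  - by apply: gram_unit; exact: row_base_free.
pose X := F^T *m invmx (F *m F^T) *m invmx (C^T *m C) *m C^T.
have AX : A *m X = C *m invmx (C^T *m C) *m C^T.
  by rewrite AE /X !mulmxA -(mulmxA C F) mulmxK.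
have XA : X *m A = F^T *m invmx (F *m F^T) *m F.
  by rewrite AE /X !mulmxA -(mulmxA _ C^T C) mulmxKV.
exists X; split; first by rewrite AX AE !mulmxA -(mulmxA _ C^T C) mulmxKV.
- by rewrite XA /X !mulmxA -(mulmxA _ F F^T) mulmxKV.
- by rewrite AX !trmx_mul trmx_inv trmx_mul !trmxK mulmxA.
- by rewrite XA !trmx_mul trmx_inv trmx_mul !trmxK mulmxA.
Qed.

Lemma pinvP m n (A : 'M[R]_(m, n)) : is_pinv A (pinv A).
Proof. by have [X AX] := is_pinv_exists A; exact: xgetPex (ex_intro _ X AX). Qed.

End PseudoInverse.

Section SVD.
Variable R : realType.

Definition orthogonal_mx n (Q : 'M[R]_n) : Prop := Q^T *m Q = 1%:M.

Definition nonincreasing_rv n (s : 'rV[R]_n) : Prop :=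
  forall i j : 'I_n, (i <= j)%N -> s 0 j <= s 0 i.

Definition is_svd n (A U : 'M[R]_n) (s : 'rV[R]_n) (V : 'M[R]_n) : Prop :=
  [/\ orthogonal_mx U, orthogonal_mx V,
      nonincreasing_rv s, (forall i, 0 <= s 0 i)
    & A = U *m diag_mx s *m V^T].

(* 1-based: entry s i is s_i for 1 <= i <= n (junk value 0 for i > n) *)
Definition entry n (s : 'rV[R]_n) (i : nat) : R :=
  if insub i.-1 is Some j then s 0 j else 0.

Section Split.
Variables (N k : nat) (hk : (k <= N)%N).

Definition lcols m (A : 'M[R]_(m, N)) : 'M[R]_(m, k) :=
  lsubmx (castmx (erefl m, esym (subnKC hk)) A).

Definition rcols m (A : 'M[R]_(m, N)) : 'M[R]_(m, N - k) :=
  rsubmx (castmx (erefl m, esym (subnKC hk)) A).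

Definition block_sq (A11 : 'M[R]_k) (A12 : 'M[R]_(k, N - k))
    (A21 : 'M[R]_(N - k, k)) (A22 : 'M[R]_(N - k)) : 'M[R]_N :=
  castmx (subnKC hk, subnKC hk) (block_mx A11 A12 A21 A22).

Definition tsvd (U : 'M[R]_N) (s : 'rV[R]_N) (V : 'M[R]_N) : 'M[R]_N :=
  lcols U *m diag_mx (lcols s) *m (lcols V)^T.

End Split.
End SVD.

Section Kronecker.
Variables (R : realType) (n : nat).
Implicit Types (A B : 'M[R]_n) (K : 'M[R]_(n * n)).

(* column stacking: position j * n + i of vec A holds A i j *)
Definition vec A : 'cV[R]_(n * n) :=
  \col_l A (mxtens_unindex l).2 (mxtens_unindex l).1.

Definition rearrange K : 'M[R]_(n * n) :=
  \matrix_(p, q)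
    K (mxtens_index ((mxtens_unindex p).2, (mxtens_unindex q).2))
      (mxtens_index ((mxtens_unindex p).1, (mxtens_unindex q).1)).

Lemma rearrange_tens A B : rearrange (A *t B) = vec A *m (vec B)^T.
Proof. by apply/matrixP => p q; rewrite !mxE big_ord1 !mxE !mxtens_indexK. Qed.

Lemma rearrange_linear : linear rearrange.
Proof. by move=> a K L; apply/matrixP => p q; rewrite !mxE. Qed.

Definition has_kron_terms K (r : nat) : Prop :=
  exists A B : 'I_r -> 'M[R]_n, K = \sum_(i < r) A i *t B i.

Definition is_kron_rank K (r : nat) : Prop :=
  has_kron_terms K r /\ forall r', has_kron_terms K r' -> (r <= r')%N.

(* the columns of u and v are the u_i and v_i *)
Definition kron_svd_sum K (r : nat) (A B : 'I_r -> 'M[R]_n) : Prop :=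
  exists (u v : 'M[R]_(n * n, r)) (s : 'rV[R]_r),
    [/\ u^T *m u = 1%:M /\ v^T *m v = 1%:M,
        nonincreasing_rv s /\ (forall i, 0 < s 0 i),
        rearrange K = \sum_(i < r) s 0 i *: (col i u *m (col i v)^T)
      & forall i, vec (A i) = Num.sqrt (s 0 i) *: col i u /\
                  vec (B i) = Num.sqrt (s 0 i) *: col i v].

Lemma rearrange_inj : injective rearrange.
Proof.
move=> K L /matrixP KL; apply/matrixP => i j.
case: (mxtens_indexP i) => i1 i2; case: (mxtens_indexP j) => j1 j2.
have := KL (mxtens_index (j1, i1)) (mxtens_index (j2, i2)).
by rewrite !mxE !mxtens_indexK.
Qed.

Lemma kron_svd_sumE K r (A B : 'I_r -> 'M[R]_n) :
  kron_svd_sum K A B -> K = \sum_(i < r) A i *t B i.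
Proof.
move=> [u [v [s [_ [_ s_gt0] KE AB]]]]; apply: rearrange_inj; rewrite KE.
have -> : rearrange (\sum_(i < r) A i *t B i)
          = \sum_(i < r) rearrange (A i *t B i).
  apply/matrixP => p q; rewrite mxE !summxE.
  by apply: eq_bigr => i _; rewrite [in RHS]mxE.
apply: eq_bigr => i _; have [Ai Bi] := AB i.
rewrite rearrange_tens Ai Bi linearZ /= -scalemxAl -scalemxAr scalerA.
by rewrite -expr2 sqr_sqrtr // ltW.
Qed.

End Kronecker.

(* Main.v *)
Require Import Defs.
From mathcomp Require Import all_boot all_order all_algebra.
From mathcomp Require Import boolp classical_sets reals ring lra.
From mathcomp Require Import fingroup perm mxtens.

(** The bound is Wedin's perturbation theorem for pseudoinverses combined with
an estimate of the distance between the two truncated operators.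

Wedin's theorem (wedin): if A and B have the same rank, then
||A^+ - B^+|| <= phi ||A^+|| ||B^+|| ||A - B||.  Split the domain of
A^+ - B^+ along the column space of A and its complement, and its codomain
along the row space of B and its complement.  In this splitting the operator
is a 2 x 2 block matrix whose corner on the two complements vanishes, because
A^+ kills the complement of the column space of A and B^+ maps into the row
space of B.  Each of the three other blocks has norm at most
e = ||A^+|| ||B^+|| ||A - B||, so the whole has norm at most e times the norm
of the matrix with rows (1, 1) and (1, 0), which is phi.  The two off-diagonal
blocks involve the gap between the row (or column) spaces of A and B in the
inconvenient direction; equality of the ranks makes the gap symmetric
(proj_gap), which is what puts both factors ||A^+|| and ||B^+|| in the bound.

Distance of the operators: let Q and Q' be the orthogonal projections on the
spans of the columns of V_k and of Vhat_k.  Then K_TSVD = K Q, and the block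
form of K in the approximate bases gives
K Vhat_k = Uhat_k Sigmahat_k + Uhat_0 What_21, hence
Khat_TSVD = K Q' - Uhat_0 What_21 Vhat_k^T.  So
||K_TSVD - Khat_TSVD|| <= ||K|| ||Q - Q'|| + ||What_21||, with
||K|| <= sigma_1.  As Q and Q' have the same rank, the symmetry of the gap
yields ||Q - Q'|| <= ||Q (1 - Q')|| (spnorm_projB), and this is at most
||V_k^T Vhat_0||.  Finally, ||Khat_TSVD^+|| <= 1 / sigmahat_k. *)

Set Implicit Arguments.
Unset Strict Implicit.
Unset Printing Implicit Defensive.

Import Order.TTheory GRing.Theory Num.Theory.
Local Open Scope ring_scope.

(** * Euclidean norm and spectral norm *)

Section Euclid.
Variable R : realType.

Definition dot n (x y : 'cV[R]_n) : R := (x^T *m y) 0 0.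

Lemma dotDl n (x y z : 'cV[R]_n) : dot (x + y) z = dot x z + dot y z.
Proof. by rewrite /dot linearD mulmxDl mxE. Qed.

Lemma dotZl n a (x z : 'cV[R]_n) : dot (a *: x) z = a * dot x z.
Proof. by rewrite /dot linearZ -scalemxAl mxE. Qed.

Lemma dotC n (x y : 'cV[R]_n) : dot x y = dot y x.
Proof. by rewrite /dot -[y in LHS]trmxK -trmx_mul mxE. Qed.

Lemma dotDr n (x y z : 'cV[R]_n) : dot z (x + y) = dot z x + dot z y.
Proof. by rewrite dotC dotDl !(dotC z). Qed.

Lemma dotZr n a (x z : 'cV[R]_n) : dot z (a *: x) = a * dot z x.
Proof. by rewrite dotC dotZl dotC. Qed.

Lemma dot_adj m n (M : 'M[R]_(m, n)) x y : dot (M *m x) y = dot x (M^T *m y).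
Proof. by rewrite /dot trmx_mul mulmxA. Qed.

Lemma norm2_ge0 n (x : 'cV[R]_n) : 0 <= norm2 x.
Proof. exact: sqrtr_ge0. Qed.

Lemma norm2_sqr n (x : 'cV[R]_n) : norm2 x ^+ 2 = dot x x.
Proof.
rewrite sqr_sqrtr ?sumr_ge0 // => [|i _]; last exact: sqr_ge0.
by rewrite /dot mxE; apply: eq_bigr => i _; rewrite mxE expr2.
Qed.

Lemma norm2_0 n : norm2 (0 : 'cV[R]_n) = 0.
Proof. by apply/eqP; rewrite -sqrf_eq0 norm2_sqr /dot mulmx0 mxE. Qed.

Lemma norm2_eq0 n (x : 'cV[R]_n) : norm2 x = 0 -> x = 0.
Proof.
move=> /eqP; rewrite sqrtr_eq0 => s_le0.
apply/colP => i; rewrite mxE; apply/eqP; rewrite -sqrf_eq0.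
have /psumr_eq0P : forall i : 'I_n, true -> 0 <= x i 0 ^+ 2.
  by move=> j _; exact: sqr_ge0.
move=> -> //; apply/eqP; rewrite eq_le s_le0 sumr_ge0 // => j _.
exact: sqr_ge0.
Qed.

Lemma norm2Z n a (x : 'cV[R]_n) : norm2 (a *: x) = `|a| * norm2 x.
Proof.
apply/eqP; rewrite -(eqrXn2 (n := 2)) ?norm2_ge0 ?mulr_ge0 ?norm2_ge0 //.
by rewrite exprMn !norm2_sqr dotZl dotZr real_normK ?num_real // mulrA.
Qed.

Lemma norm2N n (x : 'cV[R]_n) : norm2 (- x) = norm2 x.
Proof. by rewrite -scaleN1r norm2Z normrN1 mul1r. Qed.

Lemma cauchy_schwarz n (x y : 'cV[R]_n) : dot x y <= norm2 x * norm2 y.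
Proof.
have [y0|y_neq0] := eqVneq (norm2 y) 0.
  by rewrite (norm2_eq0 y0) /dot mulmx0 mxE norm2_0 mulr0.
apply: le_trans (ler_norm _) _.
rewrite -(ler_pXn2r (n := 2)) // ?nnegrE ?mulr_ge0 ?norm2_ge0 //.
rewrite real_normK ?num_real // exprMn !norm2_sqr.
have yy_gt0 : 0 < dot y y.
  by rewrite -norm2_sqr exprn_gt0 // lt_neqAle eq_sym y_neq0 norm2_ge0.
have := sqr_ge0 (norm2 (dot y y *: x + (- dot x y) *: y)).
rewrite norm2_sqr dotDl !dotDr !dotZl !dotZr (dotC y x) => h.
have : 0 <= dot y y * (dot x x * dot y y - dot x y ^+ 2).
  by apply: le_trans h _; rewrite le_eqVlt; apply/orP; left; apply/eqP; ring.
by rewrite pmulr_rge0 // subr_ge0.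
Qed.

Lemma norm2D n (x y : 'cV[R]_n) : norm2 (x + y) <= norm2 x + norm2 y.
Proof.
rewrite -(ler_pXn2r (n := 2)) // ?nnegrE ?addr_ge0 ?norm2_ge0 //.
rewrite norm2_sqr dotDl !dotDr (dotC y x) -!norm2_sqr.
by have := cauchy_schwarz x y; lra.
Qed.

Lemma norm2_isometry m n (Q : 'M[R]_(m, n)) x :
  Q^T *m Q = 1%:M -> norm2 (Q *m x) = norm2 x.
Proof.
move=> QQ; apply/eqP; rewrite -(eqrXn2 (n := 2)) ?norm2_ge0 //.
by rewrite !norm2_sqr dot_adj mulmxA QQ mul1mx.
Qed.

(** Only used to see that the supremum defining the spectral norm is finite. *)
Lemma norm2_frobenius m n (M : 'M[R]_(m, n)) x :
  norm2 (M *m x) ^+ 2 <= (\sum_i norm2 (row i M)^T ^+ 2) * norm2 x ^+ 2.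
Proof.
rewrite sqr_sqrtr ?sumr_ge0 // => [|i _]; last exact: sqr_ge0.
rewrite mulr_suml; apply: ler_sum => i _; rewrite -exprMn.
have -> : (M *m x) i 0 = dot (row i M)^T x.
  by rewrite /dot trmxK -row_mul [RHS]mxE.
rewrite -[leLHS]real_normK ?num_real //.
rewrite ler_pXn2r // ?nnegrE ?mulr_ge0 ?norm2_ge0 // ler_norml.
rewrite cauchy_schwarz andbT lerNl.
have := cauchy_schwarz (- (row i M)^T) x.
by rewrite norm2N -scaleN1r dotZl mulN1r.
Qed.

Lemma spnorm_has_sup m n (M : 'M[R]_(m, n)) :
  has_sup [set norm2 (M *m x) | x in [set x : 'cV[R]_n | norm2 x <= 1]]%classic.
Proof.
split; first by exists (norm2 (M *m 0)); exists 0 => //=; rewrite norm2_0 ler01.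
set F := \sum_i norm2 (row i M)^T ^+ 2.
have F_ge0 : 0 <= F by apply: sumr_ge0 => i _; exact: sqr_ge0.
exists (1 + F) => _ [x /= x_le1 <-].
have : norm2 (M *m x) ^+ 2 <= F.
  apply: le_trans (norm2_frobenius M x) _; rewrite ler_piMr //.
  by rewrite expr_le1 // norm2_ge0.
by have := norm2_ge0 (M *m x); nra.
Qed.

Lemma spnorm_ge0 m n (M : 'M[R]_(m, n)) : 0 <= spnorm M.
Proof.
apply: (sup_upper_bound (spnorm_has_sup M)); exists 0 => /=.
  by rewrite norm2_0 ler01.
by rewrite mulmx0 norm2_0.
Qed.

Lemma spnormP m n (M : 'M[R]_(m, n)) x : norm2 (M *m x) <= spnorm M * norm2 x.
Proof.
have [/norm2_eq0 ->|x_neq0] := eqVneq (norm2 x) 0.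
  by rewrite mulmx0 !norm2_0 mulr0.
have x_gt0 : 0 < norm2 x by rewrite lt_neqAle eq_sym x_neq0 norm2_ge0.
have inv_ge0 : 0 <= (norm2 x)^-1 by rewrite invr_ge0 norm2_ge0.
rewrite -ler_pdivrMr //.
apply: (sup_upper_bound (spnorm_has_sup M)); exists ((norm2 x)^-1 *: x) => /=.
  by rewrite norm2Z ger0_norm // mulVf.
by rewrite -scalemxAr norm2Z ger0_norm // mulrC.
Qed.

Lemma spnorm_le m n (M : 'M[R]_(m, n)) c :
  0 <= c -> (forall x, norm2 (M *m x) <= c * norm2 x) -> spnorm M <= c.
Proof.
move=> c_ge0 Mc; apply: ge_sup; first by case: (spnorm_has_sup M).
move=> _ [x /= x_le1 <-]; apply: le_trans (Mc x) _.
by rewrite ler_piMr.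
Qed.

Lemma spnormD m n (M N : 'M[R]_(m, n)) : spnorm (M + N) <= spnorm M + spnorm N.
Proof.
apply: spnorm_le => [|x]; first by rewrite addr_ge0 ?spnorm_ge0.
by rewrite mulmxDl mulrDl (le_trans (norm2D _ _)) // lerD ?spnormP.
Qed.

Lemma spnormM m n p (M : 'M[R]_(m, n)) (N : 'M[R]_(n, p)) :
  spnorm (M *m N) <= spnorm M * spnorm N.
Proof.
apply: spnorm_le => [|x]; first by rewrite mulr_ge0 ?spnorm_ge0.
rewrite -mulmxA (le_trans (spnormP _ _)) // -mulrA.
by rewrite ler_wpM2l ?spnorm_ge0 ?spnormP.
Qed.

Lemma spnormN m n (M : 'M[R]_(m, n)) : spnorm (- M) = spnorm M.
Proof.
rewrite /spnorm; congr sup; apply/seteqP; split => _ [x x1 <-]; exists x => //.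
all: by rewrite mulNmx norm2N.
Qed.

(** ||M^T x||^2 = <x, M M^T x> <= ||x|| ||M|| ||M^T x||. *)
Lemma spnorm_tr m n (M : 'M[R]_(m, n)) : spnorm M^T = spnorm M.
Proof.
suff le_tr p q (N : 'M[R]_(p, q)) : spnorm N^T <= spnorm N.
  by apply/eqP; rewrite eq_le le_tr -{1}[M]trmxK le_tr.
apply: spnorm_le => [|x]; first exact: spnorm_ge0.
have [->|y_neq0] := eqVneq (norm2 (N^T *m x)) 0.
  by rewrite mulr_ge0 ?spnorm_ge0 ?norm2_ge0.
have y_gt0 : 0 < norm2 (N^T *m x) by rewrite lt_neqAle eq_sym y_neq0 norm2_ge0.
rewrite -(ler_pM2l y_gt0) -expr2 norm2_sqr dot_adj trmxK.
apply: le_trans (cauchy_schwarz _ _) _.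
rewrite mulrC mulrA [_ * spnorm N]mulrC.
by rewrite ler_wpM2r ?norm2_ge0 ?spnormP.
Qed.

Lemma spnorm_isometry m n (Q : 'M[R]_(m, n)) :
  Q^T *m Q = 1%:M -> spnorm Q <= 1.
Proof.
by move=> QQ; apply: spnorm_le => // x; rewrite norm2_isometry ?mul1r.
Qed.

Lemma spnorm_sandwich m n p q (L : 'M[R]_(m, n)) (M : 'M[R]_(n, p))
    (N : 'M[R]_(p, q)) :
  spnorm L <= 1 -> spnorm N <= 1 -> spnorm (L *m M *m N) <= spnorm M.
Proof.
move=> L1 N1; apply: le_trans (spnormM _ _) _.
rewrite -[leRHS]mulr1 ler_pM ?spnorm_ge0 //.
by apply: le_trans (spnormM _ _) _; rewrite ler_piMl ?spnorm_ge0.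
Qed.

Lemma spnorm_diag n (d : 'rV[R]_n) c :
  0 <= c -> (forall i, `|d 0 i| <= c) -> spnorm (diag_mx d) <= c.
Proof.
move=> c_ge0 dc; apply: spnorm_le => // x.
rewrite -(ler_pXn2r (n := 2)) // ?nnegrE ?mulr_ge0 ?norm2_ge0 //.
rewrite exprMn !sqr_sqrtr; try by rewrite sumr_ge0 // => i _; exact: sqr_ge0.
rewrite mulr_sumr; apply: ler_sum => i _.
rewrite mul_diag_mx mxE exprMn ler_wpM2r ?sqr_ge0 //.
by rewrite -[X in X <= _]real_normK ?num_real // ler_pXn2r ?nnegrE.
Qed.

(** * Orthogonal projections of equal rank *)

Definition orth_proj n (P : 'M[R]_n) : Prop := P^T = P /\ P *m P = P.

Lemma orth_projC n (P : 'M[R]_n) : orth_proj P -> orth_proj (1%:M - P).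
Proof.
move=> [Ps Pi]; split; first by rewrite linearB /= trmx1 Ps.
by rewrite mulmxBl mul1mx mulmxBr mulmx1 Pi subrr subr0.
Qed.

Lemma orth_proj_frame n k (Q : 'M[R]_(n, k)) :
  Q^T *m Q = 1%:M -> orth_proj (Q *m Q^T).
Proof.
move=> QQ; split; first by rewrite trmx_mul trmxK.
by rewrite mulmxA -(mulmxA Q) QQ mulmx1.
Qed.

Lemma pythagoras n (P : 'M[R]_n) x : orth_proj P ->
  norm2 x ^+ 2 = norm2 (P *m x) ^+ 2 + norm2 ((1%:M - P) *m x) ^+ 2.
Proof.
move=> P_proj; have [Cs Ci] := orth_projC P_proj; case: P_proj => [Ps Pi].
rewrite !norm2_sqr !dot_adj Ps Cs !mulmxA Pi Ci -dotDr -mulmxDl.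
by rewrite addrC subrK mul1mx.
Qed.

Lemma norm2_proj_le n (P : 'M[R]_n) x : orth_proj P ->
  norm2 (P *m x) <= norm2 x.
Proof.
move=> P_proj; rewrite -(ler_pXn2r (n := 2)) // ?nnegrE ?norm2_ge0 //.
by rewrite (pythagoras x P_proj) lerDl sqr_ge0.
Qed.

Lemma spnorm_proj n (P : 'M[R]_n) : orth_proj P -> spnorm P <= 1.
Proof. by move=> hP; apply: spnorm_le => // x; rewrite mul1r norm2_proj_le. Qed.

(** If some nonzero vector of the range of Q were killed by P, then (1 - P) Q
would have norm at least 1; so P is injective on the range of Q, and by
equality of ranks it maps the range of Q onto the range of P. *)
Lemma proj_onto n (P Q : 'M[R]_n) (y : 'cV[R]_n) :
    orth_proj P -> orth_proj Q -> \rank P = \rank Q ->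
    spnorm ((1%:M - P) *m Q) < 1 -> P *m y = y ->
  exists2 x : 'cV[R]_n, Q *m x = x & P *m x = y.
Proof.
move=> [Ps Pi] [Qs Qi] rPQ c_lt1 Py.
have QP0 : (Q :&: kermx P = 0)%MS.
  apply/eqP/rowV0P => v; rewrite sub_capmx.
  move=> /andP[/submxP[w vE] /sub_kermxP vP].
  have Qv : Q *m v^T = v^T by rewrite -[X in X *m _]Qs -trmx_mul vE -mulmxA Qi.
  have Pv : P *m v^T = 0 by rewrite -[X in X *m _]Ps -trmx_mul vP trmx0.
  have := spnormP ((1%:M - P) *m Q) v^T.
  rewrite -mulmxA Qv mulmxBl mul1mx Pv subr0 => le_c.
  have /norm2_eq0 : norm2 v^T = 0 by have := norm2_ge0 v^T; nra.
  by move=> /(congr1 trmx); rewrite trmxK trmx0.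
have rQP : \rank (Q *m P) = \rank P.
  by have := mxrank_mul_ker Q P; rewrite QP0 mxrank0 addn0 rPQ.
have PQP : (P <= Q *m P)%MS.
  by have := mxrank_leqif_eq (submxMl Q P) => /leqifP; rewrite rQP ltnn;
     case: ifP => // /andP[].
have /submxP[w yE] : (y^T <= Q *m P)%MS.
  by apply: submx_trans PQP; rewrite -Py trmx_mul Ps submxMl.
exists (Q *m w^T); first by rewrite mulmxA Qi.
by rewrite -[y]trmxK yE !trmx_mul Ps Qs mulmxA.
Qed.

(** For y in the range of P, take x in the range of Q with P x = y.  With c the
norm of (1 - P) Q, Pythagoras gives (1 - c^2) ||x||^2 <= ||y||^2, while
||y||^2 = <y, x> = <Q y, x> <= ||Q y|| ||x||; hence
(1 - c^2) ||y||^2 <= ||Q y||^2, that is ||(1 - Q) y|| <= c ||y||.  For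
c >= 1 there is nothing to prove.  Exchanging P and Q gives equality. *)
Lemma proj_gap n (P Q : 'M[R]_n) :
    orth_proj P -> orth_proj Q -> \rank P = \rank Q ->
  spnorm ((1%:M - Q) *m P) <= spnorm ((1%:M - P) *m Q).
Proof.
move=> hP hQ rPQ; set c := leRHS.
have c_ge0 : 0 <= c by exact: spnorm_ge0.
suff gap (y : 'cV[R]_n) : P *m y = y -> norm2 ((1%:M - Q) *m y) <= c * norm2 y.
  apply: (spnorm_le c_ge0) => x; rewrite -mulmxA.
  have PPx : P *m (P *m x) = P *m x by rewrite mulmxA hP.2.
  apply: le_trans (gap _ PPx) _.
  by apply: ler_wpM2l => //; exact: norm2_proj_le.
move=> Py; have [c_ge1|c_lt1] := leP 1 c.
  apply: le_trans (norm2_proj_le _ (orth_projC hQ)) _.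
  by rewrite ler_peMl ?norm2_ge0.
have [x Qx Px] := proj_onto hP hQ rPQ c_lt1 Py.
have x_le : norm2 ((1%:M - P) *m x) <= c * norm2 x.
  by rewrite -{1}Qx mulmxA spnormP.
have y_le : norm2 y ^+ 2 <= norm2 (Q *m y) * norm2 x.
  rewrite norm2_sqr -{2}Px -{1}hP.1 -dot_adj Py -{1}Qx -{1}hQ.1 -dot_adj.
  exact: cauchy_schwarz.
have := pythagoras x hP; rewrite Px => xE.
have := pythagoras y hQ.
move: (norm2_ge0 x) (norm2_ge0 y) (norm2_ge0 (Q *m y)) x_le y_le xE.
move: (norm2_ge0 ((1%:M - P) *m x)) (norm2_ge0 ((1%:M - Q) *m y)).
(* a, b, q, d, e: the norms of x, y, Q y, (1 - P) x and (1 - Q) y *)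
move: (norm2 x) (norm2 y) (norm2 (Q *m y)) => a b q.
move: (norm2 _) (norm2 _) => e d d0 e0 a0 b0 q0 dc bqa aE bE.
rewrite -(ler_pXn2r (n := 2)) // ?nnegrE ?mulr_ge0 // exprMn.
have [b0E|b_neq0] := eqVneq b 0.
  by move: bE (sqr_ge0 q); rewrite b0E expr0n /= mulr0; lra.
have b_gt0 : 0 < b ^+ 2 by rewrite exprn_gt0 // lt_neqAle eq_sym b_neq0.
have d2 : d ^+ 2 <= c ^+ 2 * a ^+ 2.
  by rewrite -exprMn ler_pXn2r ?nnegrE ?mulr_ge0.
have b4 : b ^+ 2 * b ^+ 2 <= q ^+ 2 * a ^+ 2.
  by rewrite -expr2 -exprMn ler_pXn2r ?nnegrE ?mulr_ge0 ?sqr_ge0.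
have c2 : c ^+ 2 <= 1 by rewrite expr_le1 // ltW.
have key : (1 - c ^+ 2) * b ^+ 2 <= q ^+ 2.
  rewrite -(ler_pM2r b_gt0) -mulrA.
  apply: le_trans (ler_wpM2l _ b4) _; first by rewrite subr_ge0.
  by rewrite mulrCA ler_wpM2l ?sqr_ge0 //; lra.
by lra.
Qed.

(** P - Q = P (1 - Q) - (1 - P) Q, where the two terms have orthogonal ranges
and act on orthogonal components of the argument; so the norm is at most
the larger of theirs, and proj_gap (after transposing) compares the two. *)
Lemma spnorm_projB n (P Q : 'M[R]_n) :
    orth_proj P -> orth_proj Q -> \rank P = \rank Q ->
  spnorm (P - Q) <= spnorm (P *m (1%:M - Q)).
Proof.
move=> hP hQ rPQ; set c := leRHS.
have c_ge0 : 0 <= c by exact: spnorm_ge0.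
have cE : spnorm ((1%:M - Q) *m P) = c.
  by rewrite -spnorm_tr trmx_mul hP.1 (orth_projC hQ).1.
have gap : spnorm ((1%:M - P) *m Q) <= c by rewrite -cE proj_gap.
apply: (spnorm_le c_ge0) => x.
rewrite -(ler_pXn2r (n := 2)) // ?nnegrE ?mulr_ge0 ?norm2_ge0 // exprMn.
rewrite (pythagoras _ hP) [in leRHS](pythagoras _ hQ).
have -> : P *m ((P - Q) *m x) = P *m (1%:M - Q) *m ((1%:M - Q) *m x).
  rewrite [RHS]mulmxA -[in RHS](mulmxA P) (orth_projC hQ).2 [LHS]mulmxA.
  by rewrite !mulmxBr hP.2 mulmx1.
have -> : (1%:M - P) *m ((P - Q) *m x) = - ((1%:M - P) *m Q *m (Q *m x)).
  rewrite -[_ *m Q *m _]mulmxA (mulmxA Q) hQ.2 !mulmxA -mulNmx; congr (_ *m _).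
  by rewrite mulmxBr mulmxBl mul1mx hP.2 subrr sub0r.
rewrite norm2N [leRHS]mulrDr addrC -!exprMn.
rewrite lerD // ler_pXn2r ?nnegrE ?mulr_ge0 ?norm2_ge0 ?spnormP //.
by apply: le_trans (spnormP _ _) _; rewrite ler_wpM2r ?norm2_ge0.
Qed.

End Euclid.

(** * Wedin's theorem *)

Section Wedin.
Variable R : realType.

Lemma is_pinv_tr m n (A : 'M[R]_(m, n)) X : is_pinv A X -> is_pinv A^T X^T.
Proof.
move=> [AXA XAX AXs XAs]; split.
- by rewrite -!trmx_mul mulmxA AXA.
- by rewrite -!trmx_mul mulmxA XAX.
- by rewrite -trmx_mul XAs.
- by rewrite -trmx_mul AXs.
Qed.

Lemma pinv_row_proj m n (A : 'M[R]_(m, n)) X : is_pinv A X ->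
  orth_proj (X *m A) /\ \rank (X *m A) = \rank A.
Proof.
move=> [AXA XAX _ XAs]; split; first by split; rewrite // mulmxA XAX.
apply/eqP; rewrite eqn_leq mxrankM_maxr /= -[X in (\rank X <= _)%N]AXA.
by rewrite -mulmxA mxrankM_maxr.
Qed.

Lemma pinv_col_proj m n (A : 'M[R]_(m, n)) X : is_pinv A X ->
  orth_proj (A *m X).
Proof. by move=> [AXA _ AXs _]; split; rewrite // mulmxA AXA. Qed.

(** The gap, bounded in the opposite direction: on the complement of the row
space of A, Y B acts as Y (B - A).  This gives the factor Y where a direct
estimate would give X. *)
Lemma row_space_gap m n (A B : 'M[R]_(m, n)) X Y :
    is_pinv A X -> is_pinv B Y -> \rank A = \rank B ->
  spnorm ((1%:M - Y *m B) *m (X *m A)) <= spnorm Y * spnorm (A - B).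
Proof.
move=> hX hY rAB.
have [hP rP] := pinv_row_proj hX; have [hQ rQ] := pinv_row_proj hY.
apply: le_trans (proj_gap hP hQ _) _; first by rewrite rP rQ.
rewrite -spnorm_tr trmx_mul hQ.1 (orth_projC hP).1.
have -> : Y *m B *m (1%:M - X *m A) = Y *m (B - A) *m (1%:M - X *m A).
  have [AXA _ _ _] := hX.
  have A0 : A *m (1%:M - X *m A) = 0 by rewrite mulmxBr mulmx1 mulmxA AXA subrr.
  by rewrite -!mulmxA [in RHS]mulmxBl A0 subr0.
apply: le_trans (spnormM _ _) _.
rewrite -[leRHS]mulr1 ler_pM ?spnorm_ge0 ?(spnorm_proj (orth_projC hP)) //.
by apply: le_trans (spnormM _ _) _; rewrite -(spnormN (A - B)) opprB.
Qed.

Lemma golden_ge0 : 0 <= golden R.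
Proof. by rewrite divr_ge0 // addr_ge0 ?sqrtr_ge0. Qed.

Lemma golden_sqr : golden R ^+ 2 = golden R + 1.
Proof.
have s5 : Num.sqrt 5 ^+ 2 = 5 :> R by rewrite sqr_sqrtr.
by rewrite /golden; lra.
Qed.

(** The square of the norm of the matrix with rows (1, 1) and (1, 0) is phi^2;
for the eigenvalue phi^2 of its Gram matrix, the defect is
(phi - 1) (p - phi q)^2. *)
Lemma golden_block (p q : R) :
  (p + q) ^+ 2 + p ^+ 2 <= golden R ^+ 2 * (p ^+ 2 + q ^+ 2).
Proof.
have := golden_sqr; have := golden_ge0.
move: (golden R) => g g_ge0 g2.
have g_ge1 : 1 <= g by nra.
have : 0 <= (g - 1) * (p - g * q) ^+ 2.
  by rewrite mulr_ge0 ?sqr_ge0 // subr_ge0.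
have -> : (g - 1) * (p - g * q) ^+ 2
   = (g - 1) * p ^+ 2 - 2 * (p * q) + g * q ^+ 2
     + (g ^+ 2 - (g + 1)) * (g * q ^+ 2 - 2 * (p * q)) by ring.
by rewrite g2 subrr mul0r addr0; lra.
Qed.

Lemma wedin m n (A B : 'M[R]_(m, n)) X Y :
    is_pinv A X -> is_pinv B Y -> \rank A = \rank B ->
  spnorm (X - Y) <= golden R * (spnorm X * spnorm Y * spnorm (A - B)).
Proof.
move=> hX hY rAB; set e := _ * spnorm (A - B).
have e_ge0 : 0 <= e by rewrite !mulr_ge0 ?spnorm_ge0.
have [AXA XAX AXs XAs] := hX; have [BYB YBY BYs YBs] := hY.
have hP := pinv_col_proj hX; have [hQ _] := pinv_row_proj hY.
have hP' := orth_projC hP.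
(* the three nonzero blocks of X - Y *)
have diag_block : spnorm (Y *m (A - B) *m X) <= e.
  apply: le_trans (spnormM _ _) _; rewrite /e mulrC -mulrA.
  by rewrite ler_wpM2l ?spnorm_ge0 // spnormM.
have col_block : spnorm (Y *m (1%:M - A *m X)) <= e.
  (* row_space_gap for the transposes, with the roles of A and B exchanged *)
  rewrite -{1}YBY -!mulmxA (mulmxA B).
  apply: le_trans (spnormM _ _) _; rewrite /e mulrAC [leRHS]mulrC.
  rewrite ler_wpM2l ?spnorm_ge0 // -spnorm_tr trmx_mul hP'.1 -AXs !trmx_mul.
  apply: le_trans (row_space_gap (is_pinv_tr hY) (is_pinv_tr hX) _) _.
    by rewrite !mxrank_tr.
  have -> : B^T - A^T = (- (A - B))^T by rewrite opprB linearB.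
  by rewrite !spnorm_tr spnormN.
have row_block : spnorm ((1%:M - Y *m B) *m X) <= e.
  rewrite -{1}XAX mulmxA.
  apply: le_trans (spnormM _ _) _; rewrite /e -mulrA mulrC.
  by rewrite ler_wpM2l ?spnorm_ge0 // row_space_gap.
clearbody e.
have ge_ge0 : 0 <= golden R * e by rewrite mulr_ge0 ?golden_ge0.
apply: (spnorm_le ge_ge0) => x.
rewrite -(ler_pXn2r (n := 2)) // ?nnegrE ?(mulr_ge0 ge_ge0) ?norm2_ge0 //.
have -> : (golden R * e * norm2 x) ^+ 2
          = e ^+ 2 * (golden R ^+ 2 * norm2 x ^+ 2) by ring.
rewrite (pythagoras _ hQ) (pythagoras x hP).
have XPx : X *m (A *m X *m x) = X *m x by rewrite !mulmxA XAX.
have P'P'x : (1%:M - A *m X) *m ((1%:M - A *m X) *m x) = (1%:M - A *m X) *m x.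
  by rewrite mulmxA hP'.2.
set p := norm2 (A *m X *m x); set q := norm2 ((1%:M - A *m X) *m x).
(* components of (X - Y) x inside and outside the row space of B, in terms of
   those of x inside and outside the column space of A *)
have in_rowB : norm2 (Y *m B *m ((X - Y) *m x)) <= e * (p + q).
  have -> : Y *m B *m ((X - Y) *m x)
    = - (Y *m (A - B) *m X *m (A *m X *m x))
      - Y *m (1%:M - A *m X) *m ((1%:M - A *m X) *m x).
    rewrite -[_ *m X *m _]mulmxA XPx -[_ *m ((1%:M - _) *m x)]mulmxA P'P'x.
    rewrite [LHS]mulmxA !(mulmxA Y) (mulmxA _ X x) -mulNmx -mulmxBl.
    congr (_ *m x).
    by rewrite !mulmxBr mulmxBl mulmx1 !mulmxA YBY !opprB addrA subrK.
  rewrite -opprD norm2N (le_trans (norm2D _ _)) // mulrDr.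
  by rewrite lerD // (le_trans (spnormP _ _)) // ler_wpM2r ?norm2_ge0.
have off_rowB : norm2 ((1%:M - Y *m B) *m ((X - Y) *m x)) <= e * p.
  have -> : (1%:M - Y *m B) *m ((X - Y) *m x)
    = (1%:M - Y *m B) *m X *m (A *m X *m x).
    rewrite -mulmxA XPx [LHS]mulmxA mulmxBr [_ *m Y]mulmxBl mul1mx YBY subrr.
    by rewrite subr0 mulmxA.
  by rewrite (le_trans (spnormP _ _)) // ler_wpM2r ?norm2_ge0.
have p_ge0 : 0 <= p by exact: norm2_ge0.
have q_ge0 : 0 <= q by exact: norm2_ge0.
apply: (@le_trans _ _ ((e * (p + q)) ^+ 2 + (e * p) ^+ 2)).
  by apply: lerD; rewrite ler_pXn2r ?nnegrE ?mulr_ge0 ?addr_ge0 ?norm2_ge0 //.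
rewrite (exprMn _ e (p + q)) (exprMn _ e p) -mulrDr ler_wpM2l ?sqr_ge0 //.
exact: golden_block.
Qed.
End Wedin.

(** * Column blocks, Kronecker products and truncated decompositions *)

Section Blocks.
Variable R : realType.

Lemma lcolsE N k (hk : (k <= N)%N) m (A : 'M[R]_(m, N)) i (j : 'I_k) :
  lcols hk A i j = A i (widen_ord hk j).
Proof. by rewrite mxE castmxE cast_ord_id; congr (A _ _); apply: val_inj. Qed.

Lemma lcols_mulmx N k (hk : (k <= N)%N) m p (M : 'M[R]_(m, p)) (A : 'M_(p, N)) :
  lcols hk (M *m A) = M *m lcols hk A.
Proof.
apply/matrixP => i j; rewrite lcolsE !mxE.
by apply: eq_bigr => l _; rewrite lcolsE.
Qed.

Lemma lcols_mul_diag N k (hk : (k <= N)%N) m (A : 'M[R]_(m, N)) (d : 'rV_N) :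
  lcols hk A *m diag_mx (lcols hk d) = lcols hk (A *m diag_mx d).
Proof.
by apply/matrixP => i j; rewrite mul_mx_diag mxE !lcolsE mul_mx_diag mxE.
Qed.

Lemma lcols_mul_block N k (hk : (k <= N)%N) m (A : 'M[R]_(m, N))
    B11 B12 B21 B22 :
  lcols hk (A *m block_sq hk B11 B12 B21 B22)
  = lcols hk A *m B11 + rcols hk A *m B21.
Proof.
rewrite /lcols /rcols /block_sq.
move: (subnKC hk) B12 B21 B22; move: (N - k)%N => l e B12 B21 B22; subst N.
by rewrite !castmx_id -[A in LHS]hsubmxK mul_row_block row_mxKl.
Qed.

Lemma rcols_mul_block N k (hk : (k <= N)%N) m (A : 'M[R]_(m, N))
    B11 B12 B21 B22 :
  rcols hk (A *m block_sq hk B11 B12 B21 B22)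
  = lcols hk A *m B12 + rcols hk A *m B22.
Proof.
rewrite /lcols /rcols /block_sq.
move: (subnKC hk) B12 B21 B22; move: (N - k)%N => l e B12 B21 B22; subst N.
by rewrite !castmx_id -[A in LHS]hsubmxK mul_row_block row_mxKr.
Qed.

Lemma diag_add_block N k (hk : (k <= N)%N) (d : 'rV[R]_N) B11 B12 B21 B22 :
  diag_mx d + block_sq hk B11 B12 B21 B22
  = block_sq hk (diag_mx (lcols hk d) + B11) B12
                B21 (diag_mx (rcols hk d) + B22).
Proof.
rewrite /lcols /rcols /block_sq.
move: (subnKC hk) B12 B21 B22; move: (N - k)%N => l e B12 B21 B22; subst N.
rewrite !castmx_id -[d in LHS]hsubmxK diag_mx_row add_block_mx.
by rewrite !add0r.
Qed.

Lemma cols_orthogonal N k (hk : (k <= N)%N) (Q : 'M[R]_N) : orthogonal_mx Q ->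
  [/\ (lcols hk Q)^T *m lcols hk Q = 1%:M, (rcols hk Q)^T *m rcols hk Q = 1%:M
    & lcols hk Q *m (lcols hk Q)^T + rcols hk Q *m (rcols hk Q)^T = 1%:M].
Proof.
rewrite /orthogonal_mx /lcols /rcols.
move: (subnKC hk); move: (N - k)%N => l e; subst N; rewrite castmx_id => QQ.
have := mulmx1C QQ; move: QQ; rewrite -[Q]hsubmxK tr_row_mx row_mxKl row_mxKr.
rewrite mul_col_row mul_row_col scalar_mx_block => /eq_block_mx[l1 _ _ r1] lr.
by split.
Qed.

Lemma le_entry_first N (s : 'rV[R]_N) i :
  nonincreasing_rv s -> s 0 i <= entry s 1.
Proof.
move=> s_dec; rewrite /entry /=.
have N_gt0 : (0 < N)%N by case: i => i; apply: leq_ltn_trans.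
by rewrite insubT; apply: s_dec.
Qed.

Lemma entry_le N (s : 'rV[R]_N) k (i : 'I_N) :
  nonincreasing_rv s -> (k <= N)%N -> (i < k)%N -> entry s k <= s 0 i.
Proof.
case: k => // k s_dec kN ik; rewrite /entry /=.
by rewrite insubT; apply: s_dec.
Qed.

End Blocks.

Lemma tensmx_orthogonal (R : realType) m n (C : 'M[R]_m) (D : 'M[R]_n) :
  orthogonal_mx C -> orthogonal_mx D -> orthogonal_mx (C *t D).
Proof.
move=> CC DD; rewrite /orthogonal_mx trmx_tens tensmx_mul CC DD.
apply/matrixP => i j; case: (mxtens_indexP i) => i1 i2.
case: (mxtens_indexP j) => j1 j2; rewrite tensmxE !mxE -natrM mulnb.
by rewrite (can_eq (@mxtens_indexK m n)).
Qed.

Section Frames.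
Variables (R : realType) (m n k : nat).
Variables (U : 'M[R]_(m, k)) (V : 'M[R]_(n, k)).
Hypotheses (UU : U^T *m U = 1%:M) (VV : V^T *m V = 1%:M).

Lemma frame_rank (D : 'M[R]_k) : \rank (U *m D *m V^T) = \rank D.
Proof.
apply/eqP; rewrite eqn_leq; apply/andP; split.
  exact: leq_trans (mxrankM_maxl _ _) (mxrankM_maxr _ _).
have {1}-> : D = U^T *m (U *m D *m V^T) *m V.
  by rewrite !mulmxA UU mul1mx -mulmxA VV mulmx1.
exact: leq_trans (mxrankM_maxl _ _) (mxrankM_maxr _ _).
Qed.

Lemma frame_pinv (D D' : 'M[R]_k) : D *m D' = 1%:M ->
  is_pinv (U *m D *m V^T) (V *m D' *m U^T).
Proof.
move=> DD'; have D'D := mulmx1C DD'.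
have AX : U *m D *m V^T *m (V *m D' *m U^T) = U *m U^T.
  by rewrite !mulmxA -(mulmxA _ V^T V) VV mulmx1 -(mulmxA U) DD' mulmx1.
have XA : V *m D' *m U^T *m (U *m D *m V^T) = V *m V^T.
  by rewrite !mulmxA -(mulmxA _ U^T U) UU mulmx1 -(mulmxA V) D'D mulmx1.
split; rewrite ?AX ?XA ?trmx_mul ?trmxK //.
  by rewrite !mulmxA -(mulmxA U) UU mulmx1.
by rewrite !mulmxA -(mulmxA V) VV mulmx1.
Qed.

Lemma frame_spnorm_pinv (d : 'rV[R]_k) c : 0 < c -> (forall i, c <= d 0 i) ->
  spnorm (pinv (U *m diag_mx d *m V^T)) <= c^-1.
Proof.
move=> c_gt0 c_le; pose d' := \row_i (d 0 i)^-1.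
have d_gt0 i : 0 < d 0 i by apply: lt_le_trans (c_le i).
have DD' : diag_mx d *m diag_mx d' = 1%:M.
  apply/matrixP => i j; rewrite mul_diag_mx !mxE.
  by case: eqVneq => [->|_]; rewrite ?mulr0 ?mulr1n ?mulfV ?gt_eqF.
rewrite (is_pinv_uniq (pinvP _) (frame_pinv DD')).
apply: le_trans (spnorm_sandwich _ _ _) _.
- exact: spnorm_isometry.
- by rewrite spnorm_tr spnorm_isometry.
apply: spnorm_diag => [|i]; first by rewrite invr_ge0 ltW.
by rewrite mxE ger0_norm ?invr_ge0 ?(ltW (d_gt0 i)) // lef_pV2 ?posrE.
Qed.

Lemma frame_rank_diag (d : 'rV[R]_k) : (forall i, 0 < d 0 i) ->
  \rank (U *m diag_mx d *m V^T) = k.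
Proof.
move=> d_gt0; rewrite frame_rank; apply: mxrank_unit.
rewrite unitmxE det_diag unitfE; apply/prodf_neq0 => i _.
by rewrite gt_eqF.
Qed.

End Frames.

Lemma frame_proj_rank (R : realType) n k (U : 'M[R]_(n, k)) :
  U^T *m U = 1%:M -> \rank (U *m U^T) = k.
Proof. by move=> UU; rewrite -{1}[U]mulmx1 frame_rank // mxrank1. Qed.
(** * The perturbation bound *)

Theorem theorem3p2 (R : realType) (n k : nat)
  (hk1 : (1 <= k)%N) (hkN : (k < n * n)%N)
  (K : 'M[R]_(n * n))
  (* true SVD of K *)
  (U V : 'M[R]_(n * n)) (s : 'rV[R]_(n * n))
  (hK : is_svd K U s V)
  (* Kronecker sum decomposition of K, of Kronecker rank r.+1 *)
  (r : nat) (A B : 'I_r.+1 -> 'M[R]_n)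
  (hr : is_kron_rank K r.+1)
  (hAB : kron_svd_sum K A B)
  (* SVDs of the leading factors *)
  (UA VA UB VB : 'M[R]_n) (sA sB : 'rV[R]_n)
  (hA : is_svd (A ord0) UA sA VA)
  (hB : is_svd (B ord0) UB sB VB)
  (U1 S1 V1 W : 'M[R]_(n * n))
  (hU1 : U1 = UA *t UB)
  (hS1 : S1 = diag_mx sA *t diag_mx sB)
  (hV1 : V1 = VA *t VB)
  (hW : W = U1^T *m (\sum_(i < r.+1 | i != ord0) A i *t B i) *m V1)
  (* sorting permutation and conformal partition *)
  (P : 'M[R]_(n * n)) (s1 : 'rV[R]_(n * n))
  (hP : is_perm_mx P)
  (hs1 : P^T *m S1 *m P = diag_mx s1)
  (hs1_sorted : nonincreasing_rv s1)
  (W11 : 'M[R]_k) (W12 : 'M[R]_(k, n * n - k))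
  (W21 : 'M[R]_(n * n - k, k)) (W22 : 'M[R]_(n * n - k))
  (hPWP : P^T *m W *m P = block_sq (ltnW hkN) W11 W12 W21 W22)
  (* SVD of the k x k block *)
  (Ut Vt : 'M[R]_k) (sh : 'rV[R]_k)
  (ht : is_svd (diag_mx (lcols (ltnW hkN) s1) + W11) Ut sh Vt)
  (Wh21 : 'M[R]_(n * n - k, k)) (hWh21 : Wh21 = W21 *m Vt)
  (Uh Vh : 'M[R]_(n * n))
  (hUh : Uh = U1 *m P *m block_sq (ltnW hkN) Ut 0 0 1%:M)
  (hVh : Vh = V1 *m P *m block_sq (ltnW hkN) Vt 0 0 1%:M)
  (Ktsvd Khtsvd : 'M[R]_(n * n))
  (hKtsvd : Ktsvd = tsvd (ltnW hkN) U s V)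
  (hKhtsvd : Khtsvd =
     lcols (ltnW hkN) Uh *m diag_mx sh *m (lcols (ltnW hkN) Vh)^T)
  (hsk : 0 < entry s k) (hshk : 0 < entry sh k) :
  spnorm (pinv Ktsvd - pinv Khtsvd) / spnorm (pinv Ktsvd)
  <= golden R / entry sh k *
     (entry s 1 * spnorm ((lcols (ltnW hkN) V)^T *m rcols (ltnW hkN) Vh)
      + spnorm Wh21).
Proof.
set hk := ltnW hkN.
have [UU VV s_dec s_ge0 KE] := hK.
have [Uo Vo _ _ A0E] := hA; have [Uo' Vo' _ _ B0E] := hB.
have [Uto Vto sh_dec _ TE] := ht.
pose X := U1 *m P; pose Y := V1 *m P.
have U1o : orthogonal_mx U1 by rewrite hU1; apply: tensmx_orthogonal.
have V1o : orthogonal_mx V1 by rewrite hV1; apply: tensmx_orthogonal.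
have PP : P^T *m P = 1%:M.
  case/is_perm_mxP: hP => p ->.
  by rewrite tr_perm_mx -perm_mxM mulVg perm_mx1.
have mul_orth (Q : 'M[R]_(n * n)) : orthogonal_mx Q -> orthogonal_mx (Q *m P).
  by move=> QQ; rewrite /orthogonal_mx trmx_mul mulmxA -(mulmxA P^T) QQ mulmx1.
have [XX1 XX2 _] := cols_orthogonal hk (mul_orth _ U1o).
have [YY1 YY2 YY] := cols_orthogonal hk (mul_orth _ V1o).
rewrite -/X -/Y in XX1 XX2 YY1 YY2 YY.
(* K in the sorted Kronecker bases: A_1 (x) B_1 contributes the diagonal and the
   remaining Kronecker terms contribute W *)
have KY : K *m Y = X *m block_sq hk (diag_mx (lcols hk s1) + W11) W12 W21
                          (diag_mx (rcols hk s1) + W22).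
  rewrite -diag_add_block -hs1 -hPWP -mulmxDl -mulmxDr /X /Y.
  rewrite !mulmxA -(mulmxA U1) (mulmx1C PP) mulmx1; congr (_ *m P).
  rewrite (kron_svd_sumE hAB) (bigD1 ord0) //= mulmxDl mulmxDr; congr (_ + _).
    rewrite A0E B0E hU1 hS1 hV1 -!tensmx_mul -trmx_tens -hV1.
    by rewrite -(mulmxA _ V1^T) V1o mulmx1.
  by rewrite hW !mulmxA (mulmx1C U1o) mul1mx.
have KY1 : K *m lcols hk Y
    = lcols hk X *m (diag_mx (lcols hk s1) + W11) + rcols hk X *m W21.
  by rewrite -lcols_mulmx KY lcols_mul_block.
have UhE : lcols hk Uh = lcols hk X *m Ut.
  by rewrite hUh lcols_mul_block mulmx0 addr0.
have VhE : lcols hk Vh = lcols hk Y *m Vt.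
  by rewrite hVh lcols_mul_block mulmx0 addr0.
have Vh0E : rcols hk Vh = rcols hk Y.
  by rewrite hVh rcols_mul_block mulmx0 add0r mulmx1.
have UhUh : (lcols hk Uh)^T *m lcols hk Uh = 1%:M.
  by rewrite UhE trmx_mul mulmxA -(mulmxA Ut^T) XX1 mulmx1.
have VhVh : (lcols hk Vh)^T *m lcols hk Vh = 1%:M.
  by rewrite VhE trmx_mul mulmxA -(mulmxA Vt^T) YY1 mulmx1.
(* the SVD of the leading block removes everything but What_21 from the error
   of the approximate right singular vectors *)
have KVh : K *m lcols hk Vh = lcols hk Uh *m diag_mx sh + rcols hk X *m Wh21.
  rewrite VhE mulmxA KY1 mulmxDl TE UhE hWh21 !mulmxA; congr (_ + _).
  by rewrite -(mulmxA _ Vt^T) Vto mulmx1.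
have [UkUk _ _] := cols_orthogonal hk UU.
have [VkVk _ _] := cols_orthogonal hk VV.
have KVk : K *m lcols hk V = lcols hk U *m diag_mx (lcols hk s).
  by rewrite -lcols_mulmx KE -mulmxA VV mulmx1 lcols_mul_diag.
pose Q1 := lcols hk V *m (lcols hk V)^T.
pose Q2 := lcols hk Vh *m (lcols hk Vh)^T.
have Q1p : orth_proj Q1 := orth_proj_frame VkVk.
have Q2p : orth_proj Q2 := orth_proj_frame VhVh.
have rQ : \rank Q1 = \rank Q2 by rewrite !frame_proj_rank.
have Q2C : 1%:M - Q2 = rcols hk Vh *m (rcols hk Vh)^T.
  rewrite /Q2 VhE Vh0E trmx_mul mulmxA -(mulmxA _ Vt) (mulmx1C Vto) mulmx1.
  by rewrite -YY addrC addKr.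
have Khat : Khtsvd = K *m Q2 - rcols hk X *m Wh21 *m (lcols hk Vh)^T.
  by rewrite /Q2 mulmxA KVh mulmxDl addrK.
have Ktrunc : Ktsvd = K *m Q1 by rewrite hKtsvd /tsvd mulmxA KVk.
have normK : spnorm K <= entry s 1.
  rewrite KE; apply: le_trans (spnorm_sandwich _ _ _) _.
  - exact: spnorm_isometry.
  - by rewrite spnorm_tr spnorm_isometry.
  have s1_ge0 : 0 <= entry s 1.
    exact: le_trans (s_ge0 (Ordinal hkN)) (le_entry_first _ s_dec).
  by apply: spnorm_diag => // i; rewrite ger0_norm ?le_entry_first.
have normE : spnorm (Ktsvd - Khtsvd)
    <= entry s 1 * spnorm ((lcols hk V)^T *m rcols hk Vh) + spnorm Wh21.
  rewrite Ktrunc Khat opprB addrCA addrC -mulmxBr.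
  apply: le_trans (spnormD _ _) _; apply: lerD.
    apply: le_trans (spnormM _ _) _; apply: ler_pM; rewrite ?spnorm_ge0 //.
    apply: le_trans (spnorm_projB Q1p Q2p rQ) _.
    rewrite Q2C /Q1 mulmxA -(mulmxA (lcols hk V)).
    apply: spnorm_sandwich; first exact: spnorm_isometry.
    by rewrite spnorm_tr spnorm_isometry // Vh0E.
  apply: spnorm_sandwich; first exact: spnorm_isometry.
  by rewrite spnorm_tr spnorm_isometry.
have sk_le (i : 'I_k) : entry s k <= lcols hk s 0 i.
  rewrite lcolsE.
  by apply: entry_le s_dec hk (ltn_ord i : (widen_ord hk i < k)%N).
have shk_le (i : 'I_k) : entry sh k <= sh 0 i.
  exact: (entry_le sh_dec (leqnn k) (ltn_ord i)).
have rAB : \rank Ktsvd = \rank Khtsvd.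
  rewrite hKtsvd hKhtsvd /tsvd !frame_rank_diag // => i.
  - exact: lt_le_trans (shk_le i).
  - exact: lt_le_trans (sk_le i).
have normX : spnorm (pinv Khtsvd) <= (entry sh k)^-1.
  by rewrite hKhtsvd frame_spnorm_pinv.
have rhs_ge0 := le_trans (spnorm_ge0 _) normE.
have [->|A_neq0] := eqVneq (spnorm (pinv Ktsvd)) 0.
  by rewrite invr0 mulr0 mulr_ge0 // divr_ge0 ?golden_ge0 // ltW.
have A_gt0 : 0 < spnorm (pinv Ktsvd)
  by rewrite lt_neqAle eq_sym A_neq0 spnorm_ge0.
rewrite ler_pdivrMr //.
apply: le_trans (wedin (pinvP _) (pinvP _) rAB) _.
have -> : golden R / entry sh k * (entry s 1 *
      spnorm ((lcols hk V)^T *m rcols hk Vh) + spnorm Wh21)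
      * spnorm (pinv Ktsvd)
    = golden R * (spnorm (pinv Ktsvd) * (entry sh k)^-1 * (entry s 1 *
      spnorm ((lcols hk V)^T *m rcols hk Vh) + spnorm Wh21)) by ring.
apply: ler_wpM2l; first exact: golden_ge0.
apply: ler_pM; rewrite ?normE ?mulr_ge0 ?spnorm_ge0 //.
by apply: ler_wpM2l normX; exact: spnorm_ge0.
Qed.
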